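(* Write ${}^k\widetilde{\mathcal L}^\ast_{\mathrm{one}}(n)$ for the optimal entanglement-breaking one-site loss for $n$ inputs. Let $a=d-k$ and $\widetilde n(\varepsilon)=\min\{n:\ {}^k\widetilde{\mathcal L}^\ast_{\mathrm{one}}(n)\le\varepsilon\}$. Suppose that for all input sizes $n$, $${}^k\widetilde{\mathcal L}^\ast_{\mathrm{one}}(n)\ge\left(1-8e^{-\frac{nD_{k,\min}^2}{256}}\right)\frac{a}{2(n+a)} .$$ Then, in any asymptotic regime such that $a/\varepsilon\to\infty$, $$\widetilde n(\varepsilon)\ge\frac{a}{2\varepsilon}(1-o(1))-a .$$ In particular, $$\widetilde n(\varepsilon)=\Omega\!\left(\frac a\varepsilon\right)=\Omega\!\left(\frac{d-k}\varepsilon\right).$$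
   Context: Fix a sorted spectrum $\boldsymbol p=(p_1\ge\dots\ge p_d\ge0)$, $\sum_ip_i=1$, whose $k$-th eigenvalue is non-degenerate, and set $D_{k,\min}=\min_{i\ne k}|p_k-p_i|$. The input family is $\mathcal X_{\boldsymbol p}=\{U\operatorname{diag}(\boldsymbol p)U^\dagger:U\in SU(d)\}$; for $\rho\in\mathcal X_{\boldsymbol p}$, $\psi_k(\rho)$ is the rank-one projector onto the eigenvector of $\rho$ for $p_k$. The task is to produce (or, equivalently for infidelity loss, to estimate by a density operator) the $k$-th eigenstate from $n$ copies of $\rho$. An entanglement-breaking (measurement-mediated) protocol with $n$ inputs is a channel $\widetilde{\mathcal T}(\cdot)=\int\operatorname{Tr}(M(dx)\,\cdot)\,\widehat\sigma_x$ from $\mathcal B((\mathbb C^d)^{\otimes n})$ to $\mathcal B(\mathbb C^d)$, with $M$ a POVM and $\widehat\sigma_x$ density operators on $\mathbb C^d$. Its loss on $\rho$ is the infidelity $1-\operatorname{Tr}[\psi_k(\rho)\widetilde{\mathcal T}(\rho^{\otimes n})]$. ${}^k\widetilde{\mathcal L}^\ast_{\mathrm{one}}(n)$ is the minimum over such protocols of the worst-case loss over $\mathcal X_{\boldsymbol p}$ (equivalently, of the Haar-average loss over $\mathcal X_{\boldsymbol p}$). *)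

(* Defs.v *)
(* Library world: MathComp and MathComp-Analysis. *)
From HB Require Import structures.
From mathcomp Require Import all_boot all_order all_algebra.
From mathcomp Require Import sesquilinear spectral.
From mathcomp Require Import complex.
From mathcomp Require Import all_classical all_reals all_analysis.

Set Implicit Arguments.
Unset Strict Implicit.
Unset Printing Implicit Defensive.

Import Order.TTheory GRing.Theory Num.Theory.
Import numFieldNormedType.Exports.

Local Open Scope classical_set_scope.
Local Open Scope ring_scope.
Local Open Scope complex_scope.
Local Open Scope sesquilinear_scope.

(** Eigenvalues are indexed from 0: [k : 'I_d] stands for the (k+1)-th largest
    eigenvalue, so that "d - k" reads [d - k.+1]. *)

Definition is_spectrum (R : realType) (d : nat) (p : 'I_d -> R) : Prop :=
  [/\ forall i j : 'I_d, (i <= j)%N -> p j <= p i,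
      forall i, 0 <= p i
    & \sum_i p i = 1].

Definition simple_eigenvalue (R : realType) (d : nat) (p : 'I_d -> R) (k : 'I_d) :
  Prop := forall i, i != k -> p i != p k.

(** The default value 1 of the minimum is immaterial for d >= 2, because
    differences of eigenvalues of a state are at most 1. *)
Definition gap (R : realType) (d : nat) (p : 'I_d -> R) (k : 'I_d) : R :=
  \big[Order.min/1]_(i < d | i != k) `|p k - p i|.

Definition nbelow (d : nat) (k : 'I_d) : nat := (d - k.+1)%N.

(** The order of [R[i]] makes [0 <= z] say that [z] is real and nonnegative;
    hence this condition also forces [A] to be Hermitian. *)
Definition psdmx (R : realType) (N : nat) (A : 'M[R[i]]_N) : Prop :=
  forall v : 'rV[R[i]]_N, 0 <= (v *m A *m v^t*) 0 0.

Definition density (R : realType) (N : nat) (A : 'M[R[i]]_N) : Prop :=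
  psdmx A /\ \tr A = 1.

Definition input_family (R : realType) (d : nat) (p : 'I_d -> R) :
    set 'M[R[i]]_d :=
  [set rho | exists U : 'M[R[i]]_d,
     [/\ U \is unitarymx, \det U = 1
       & rho = U *m diag_mx (\row_j (p j)%:C) *m U^t*]].

(** [eigenspace] consists of row vectors [v] with [v *m rho = c *: v]; for
    Hermitian [rho] these are the conjugate transposes of the usual (column)
    eigenvectors, and [proj_ortho] of that row space is the orthogonal projector
    onto the column eigenspace.  It has rank one when the eigenvalue is simple. *)
Definition eigenprojector (R : realType) (d : nat) (rho : 'M[R[i]]_d) (c : R) :
    'M[R[i]]_d :=
  proj_ortho (eigenspace rho c%:C).

(** The product basis of (C^d)^{(x) n} is indexed by the maps 'I_n -> 'I_d. *)
Definition tdim (n d : nat) : nat := #|{ffun 'I_n -> 'I_d}|.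

Definition tensor_power (R : realType) (n d : nat) (rho : 'M[R[i]]_d) :
    'M[R[i]]_(tdim n d) :=
  \matrix_(s, t) \prod_(i < n)
    rho ((enum_val s : {ffun 'I_n -> 'I_d}) i)
        ((enum_val t : {ffun 'I_n -> 'I_d}) i).

(** [Tr (M(.) rho)] as a set function; it is a finite measure as soon as [M] is a
    POVM and [rho] is positive semidefinite. *)
Definition born (R : realType) (N : nat) (X : Type)
    (M : set X -> 'M[R[i]]_N) (rho : 'M[R[i]]_N) (A : set X) : \bar R :=
  (complex.Re (\tr (M A *m rho)))%:E.

(** Countable additivity is required weakly, i.e. of all outcome distributions;
    in finite dimension this is the same as in any operator topology. *)
Record is_povm (R : realType) (N : nat) (disp : measure_display)
    (X : measurableType disp) (M : set X -> 'M[R[i]]_N) : Prop := IsPovm {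
  povm_psd : forall A, measurable A -> psdmx (M A) ;
  povm_set0 : M set0 = 0 ;
  povm_setT : M setT = 1%:M ;
  povm_sigma_additive :
    forall rho, psdmx rho -> semi_sigma_additive (born M rho) }.

Record eb_protocol (R : realType) (n d : nat) := EbProtocol {
  eb_disp : measure_display ;
  eb_outcome : measurableType eb_disp ;
  eb_povm : set eb_outcome -> 'M[R[i]]_(tdim n d) ;
  eb_prep : eb_outcome -> 'M[R[i]]_d ;
  eb_povmP : is_povm eb_povm ;
  eb_prep_density : forall x, density (eb_prep x) ;
  eb_prep_measurable_Re : forall i j,
    measurable_fun setT (fun x => complex.Re (eb_prep x i j)) ;
  eb_prep_measurable_Im : forall i j,
    measurable_fun setT (fun x => complex.Im (eb_prep x i j)) }.

Definition cintegral (R : realType) (disp : measure_display)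
    (X : measurableType disp) (mu : set X -> \bar R) (f : X -> R[i]) : R[i] :=
  fine (\int[mu]_x (complex.Re (f x))%:E)%E
  +i* fine (\int[mu]_x (complex.Im (f x))%:E)%E.

(** The action of the protocol on positive operators [omega] (in particular on
    all states), which determines the channel by linearity. *)
Definition eb_apply (R : realType) (n d : nat) (T : eb_protocol R n d)
    (omega : 'M[R[i]]_(tdim n d)) : 'M[R[i]]_d :=
  \matrix_(i, j)
    cintegral (born (@eb_povm R n d T) omega) (fun x => eb_prep x i j).

Definition eb_loss (R : realType) (n d : nat) (p : 'I_d -> R) (k : 'I_d)
    (T : eb_protocol R n d) (rho : 'M[R[i]]_d) : R :=
  1 - complex.Re (\tr (eigenprojector rho (p k)
                       *m eb_apply T (tensor_power n rho))).

Definition worst_loss (R : realType) (n d : nat) (p : 'I_d -> R) (k : 'I_d)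
    (T : eb_protocol R n d) : R :=
  sup [set eb_loss p k T rho | rho in input_family p].

Definition opt_loss (R : realType) (d : nat) (p : 'I_d -> R) (k : 'I_d)
    (n : nat) : R :=
  inf [set l | exists T : eb_protocol R n d, l = worst_loss p k T].

(** Least sample size reaching loss [eps]; [+oo] if there is none. *)
Definition sample_complexity (R : realType) (d : nat) (p : 'I_d -> R)
    (k : 'I_d) (eps : R) : \bar R :=
  match pselect (exists n, `[< opt_loss p k n <= eps >]) with
  | left ex => ((ex_minn ex)%:R)%:E
  | right _ => +oo%E
  end.

(* Main.v *)
(* The hypothesis says nothing for small [n], where the factor
   [1 - 8 exp (- c n)] is negative.  But ignoring an extra copy of the state
   turns a protocol on [n] copies into one on [n + 1] copies with the same
   loss, so a loss at most [eps] reached with [n] copies is reached with every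
   [N >= n] copies.  With [x = a / eps], applying the hypothesis at
   [N = max (n, floor (sqrt x) + 1)] gives
   [n >= x / 2 * (1 - O(1 / sqrt x)) - a]. *)
Require Import Defs.
From HB Require Import structures.
From mathcomp Require Import all_boot all_order all_algebra.
From mathcomp Require Import sesquilinear spectral complex.
From mathcomp Require Import lra ring.
From mathcomp Require Import all_classical all_reals all_analysis.
Import Order.TTheory GRing.Theory Num.Theory.
Import numFieldNormedType.Exports.
Local Open Scope classical_set_scope.
Local Open Scope ring_scope.
Local Open Scope sesquilinear_scope.

Set Implicit Arguments.
Unset Strict Implicit.

(** * Positive semidefinite matrices, Kraus maps and their trace adjoints *)

Lemma trmxC_mul (C : numClosedFieldType) (m n q : nat)
    (A : 'M[C]_(m, n)) (B : 'M[C]_(n, q)) :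
  (A *m B)^t* = B^t* *m A^t*.
Proof. by rewrite trmx_mul map_mxM. Qed.

Lemma psdmx1 (R : realType) (N : nat) : psdmx (1%:M : 'M[R[i]]_N).
Proof.
move=> v; rewrite mulmx1 mxE; apply: sumr_ge0 => j _.
by rewrite !mxE; exact: mul_conjC_ge0.
Qed.

Lemma psdmx_congr (R : realType) (m n : nat) (V : 'M[R[i]]_(m, n))
    (A : 'M[R[i]]_n) :
  psdmx A -> psdmx (V *m A *m V^t*).
Proof.
move=> A0 v; suff -> : v *m (V *m A *m V^t*) *m v^t* =
    (v *m V) *m A *m (v *m V)^t* by exact: A0.
by rewrite trmxC_mul !mulmxA.
Qed.

Lemma psdmx_sum (R : realType) (N m : nat) (A : 'I_m -> 'M[R[i]]_N) :
  (forall x, psdmx (A x)) -> psdmx (\sum_x A x).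
Proof.
move=> A0 v; rewrite mulmx_sumr mulmx_suml summxE.
by apply: sumr_ge0 => x _; exact: A0.
Qed.

Lemma psdmx_trace_ge0 (R : realType) (N : nat) (A : 'M[R[i]]_N) :
  psdmx A -> 0 <= \tr A.
Proof.
move=> A0; apply: sumr_ge0 => j _; have := A0 (delta_mx 0 j).
rewrite -rowE !mxE (bigD1 j) //= big1 => [|l lj].
  by rewrite !mxE !eqxx /= conjC1 mulr1 addr0.
by rewrite !mxE (negbTE lj) andbF conjC0 mulr0.
Qed.

Definition kraus (R : realType) (m N N' : nat) (V : 'I_m -> 'M[R[i]]_(N', N))
    (A : 'M[R[i]]_N) : 'M[R[i]]_N' := \sum_x V x *m A *m (V x)^t*.

Lemma psdmx_kraus (R : realType) (m N N' : nat)
    (V : 'I_m -> 'M[R[i]]_(N', N)) (A : 'M[R[i]]_N) :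
  psdmx A -> psdmx (kraus V A).
Proof. by move=> A0; apply: psdmx_sum => x; exact: psdmx_congr. Qed.

Lemma mxtrace_kraus_adj (R : realType) (m N N' : nat)
    (V : 'I_m -> 'M[R[i]]_(N', N)) (A : 'M[R[i]]_N') (B : 'M[R[i]]_N) :
  \tr (kraus (fun x => (V x)^t*) A *m B) =
  \tr (A *m kraus V B).
Proof.
rewrite mulmx_suml mulmx_sumr !raddf_sum /=; apply: eq_bigr => x _.
by rewrite trmxCK -2!mulmxA mxtrace_mulC -!mulmxA.
Qed.

(** Schrödinger and Heisenberg pictures agree: applying the map to the state before measuring gives
    the same outcome law as pulling the effects back along its adjoint. *)
Lemma born_kraus_adj (R : realType) (m N N' : nat) (X : Type)
    (V : 'I_m -> 'M[R[i]]_(N', N)) (M : set X -> 'M[R[i]]_N')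
    (rho : 'M[R[i]]_N) :
  born (fun A => kraus (fun x => (V x)^t*) (M A)) rho =
  born M (kraus V rho).
Proof. by apply/funext => A; rewrite /born mxtrace_kraus_adj. Qed.

(** The completeness relation makes the adjoint map unital, which preserves the total mass.
    Additivity is inherited because the new Born law of [rho] is the old one of the positive matrix
    [kraus V rho]. *)
Lemma is_povm_kraus_adj (R : realType) (m N N' : nat) (disp : measure_display)
    (X : measurableType disp) (V : 'I_m -> 'M[R[i]]_(N', N))
    (M : set X -> 'M[R[i]]_N') :
  \sum_x (V x)^t* *m V x = 1%:M -> is_povm M ->
  is_povm (fun A => kraus (fun x => (V x)^t*) (M A)).
Proof.
move=> V1 [M0 Mset0 MT Msigma]; split.
- by move=> A mA; apply: psdmx_kraus; exact: M0.
- by rewrite Mset0 /kraus big1// => x _; rewrite mulmx0 mul0mx.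
- by rewrite MT -V1; apply: eq_bigr => x _; rewrite trmxCK mulmx1.
- by move=> rho rho0; rewrite born_kraus_adj; apply: Msigma; exact: psdmx_kraus.
Qed.

(** * Discarding one copy: the partial trace over the first tensor factor *)

Definition ffun_cons (n d : nat) (x : 'I_d) (u : 'I_(tdim n d)) :
    'I_(tdim n.+1 d) :=
  enum_rank [ffun i : 'I_n.+1 =>
    if unlift ord0 i is Some j then (enum_val u : {ffun 'I_n -> 'I_d}) j
    else x].

(* [<x| (x) 1], acting on the first tensor factor. *)
Definition bra_head (R : realType) (n d : nat) (x : 'I_d) :
    'M[R[i]]_(tdim n d, tdim n.+1 d) := rowsub (ffun_cons x) 1%:M.

Lemma trmxC_bra_head (R : realType) (n d : nat) (x : 'I_d) :
  (bra_head R n x)^t* = colsub (ffun_cons x) 1%:M.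
Proof. by apply/matrixP => u v; rewrite !mxE conjC_nat eq_sym. Qed.

(** Head and tail invert the prepending of a letter, so each basis index [s] comes from exactly one
    pair [(x, u)]; sums over such pairs collapse to a single term. *)
Lemma ffun_cons_eq (n d : nat) (x : 'I_d) (u : 'I_(tdim n d))
    (s : 'I_(tdim n.+1 d)) :
  (s == ffun_cons x u) =
  (x == (enum_val s : {ffun 'I_n.+1 -> 'I_d}) ord0) &&
  (u == enum_rank
     [ffun j => (enum_val s : {ffun 'I_n.+1 -> 'I_d}) (lift ord0 j)]).
Proof.
apply/eqP/andP => [->|[/eqP xE /eqP uE]].
  rewrite enum_rankK ffunE unlift_none; split=> //; apply/eqP.
  apply: (canRL enum_valK); apply/ffunP => j.
  by rewrite !ffunE liftK.
apply: (canRL enum_valK); apply/ffunP => j; rewrite ffunE.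
by case: unliftP => [l|] -> //; rewrite uE enum_rankK ffunE.
Qed.

Lemma bra_head_resolution (R : realType) (n d : nat) :
  \sum_(x < d) (bra_head R n x)^t* *m bra_head R n x = 1%:M.
Proof.
apply/matrixP => s t; rewrite summxE.
pose h (s : 'I_(tdim n.+1 d)) := (enum_val s : {ffun 'I_n.+1 -> 'I_d}) ord0.
pose r (s : 'I_(tdim n.+1 d)) : 'I_(tdim n d) :=
  enum_rank [ffun j => (enum_val s : {ffun 'I_n.+1 -> 'I_d}) (lift ord0 j)].
(* In row [s], only the head of [s] as [x] and its tail as [u] give a nonzero entry of the adjoint
   of [bra_head]. *)
rewrite (bigD1 (h s)) //= [X in _ + X]big1 ?addr0 => [|x xs]; last first.
  rewrite mxE big1 // => u _; rewrite trmxC_bra_head !mxE ffun_cons_eq.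
  by rewrite -/(h s) (negbTE xs) mul0r.
rewrite mxE (bigD1 (r s)) //= [X in _ + X]big1 ?addr0 => [|u us]; last first.
  by rewrite trmxC_bra_head !mxE ffun_cons_eq -/(r s) (negbTE us) andbF mul0r.
have sE : ffun_cons (h s) (r s) = s.
  by apply/eqP; rewrite eq_sym ffun_cons_eq !eqxx.
by rewrite trmxC_bra_head !mxE sE eqxx mul1r.
Qed.

(** The Kraus map of the [bra_head] is the partial trace over the first factor. The product splits
    off its index 0, whose diagonal entries sum to the trace. *)
Lemma kraus_bra_head_tensor_power (R : realType) (n d : nat)
    (rho : 'M[R[i]]_d) :
  kraus (bra_head R n (d := d)) (tensor_power n.+1 rho) =
  \tr rho *: tensor_power n rho.
Proof.
apply/matrixP => u w; rewrite summxE mxE mulr_suml; apply: eq_bigr => x _.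
rewrite trmxC_bra_head -rowsubE mulmx_colsub mulmx1 !mxE big_ord_recl.
rewrite /ffun_cons !enum_rankK !ffunE unlift_none; congr (_ * _).
by apply: eq_bigr => j _; rewrite !ffunE liftK.
Qed.

Lemma mxtrace_input_family (R : realType) (d : nat) (p : 'I_d -> R)
    (rho : 'M[R[i]]_d) :
  is_spectrum p -> input_family p rho -> \tr rho = 1.
Proof.
move=> [_ _ p1] [U [Uu _ ->]].
(* Unitarity is defined by the product in the other order; squareness of [U] gives this one. *)
have UU : U^t* *m U = 1%:M.
  by rewrite -[X in X *m _]mul1mx mulmxKtV.
rewrite mxtrace_mulC mulmxA UU mul1mx mxtrace_diag.
under eq_bigr do rewrite mxE.
by rewrite -(rmorph_sum (real_complex R)) p1.
Qed.

Definition eb_discard (R : realType) (n d : nat) (T : eb_protocol R n d) :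
    eb_protocol R n.+1 d :=
  @EbProtocol R n.+1 d (@eb_disp R n d T) (@eb_outcome R n d T)
    (fun A => kraus (fun x => (bra_head R n x)^t*) (@eb_povm R n d T A))
    (@eb_prep R n d T)
    (is_povm_kraus_adj (bra_head_resolution R n d) (@eb_povmP R n d T))
    (@eb_prep_density R n d T) (@eb_prep_measurable_Re R n d T)
    (@eb_prep_measurable_Im R n d T).

(** Since inputs have unit trace, the two protocols have the same outcome law on every input; the
    losses thus agree state by state, before the supremum. *)
Lemma worst_loss_discard (R : realType) (n d : nat) (p : 'I_d -> R)
    (k : 'I_d) (T : eb_protocol R n d) :
  is_spectrum p -> worst_loss p k (eb_discard T) = worst_loss p k T.
Proof.
move=> hp; congr sup; apply: eq_imagel => rho rhoP.
rewrite /eb_loss; congr (1 - complex.Re (\tr (_ *m _))).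
apply/matrixP => i j; rewrite !mxE; congr cintegral.
rewrite /= born_kraus_adj kraus_bra_head_tensor_power.
by rewrite (mxtrace_input_family hp rhoP) scale1r.
Qed.

(** * Existence of protocols, and monotonicity of the optimal loss *)

Definition trivial_povm (R : realType) (N : nat) (A : set unit) : 'M[R[i]]_N :=
  ((tt \in A)%:R)%:M.

Lemma is_povm_trivial (R : realType) (N : nat) : is_povm (trivial_povm R N).
Proof.
split.
- move=> A _; rewrite /trivial_povm; case: (tt \in A); first exact: psdmx1.
  by move=> v; rewrite raddf0 mulmx0 mul0mx mxE.
- by rewrite /trivial_povm in_set0 raddf0.
- by rewrite /trivial_povm in_setT.
move=> rho rho0; have t0 : 0 <= complex.Re (\tr rho).
  by have := psdmx_trace_ge0 rho0; rewrite lecE => /andP[].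
(* The outcome law is the Dirac mass at [tt], weighted by the trace of [rho]. *)
suff -> : born (trivial_povm R N) rho = mscale (NngNum t0) (dirac tt).
  exact: measure_semi_sigma_additive.
apply/funext => A; rewrite /born /mscale /trivial_povm /= diracE -EFinM.
rewrite mul_scalar_mx mxtraceZ.
by case: (tt \in A); rewrite ?mul1r ?mulr1 ?mul0r ?mulr0.
Qed.

Lemma density_delta (R : realType) (d : nat) (k : 'I_d) :
  density (delta_mx k k : 'M[R[i]]_d).
Proof.
split; last first.
  rewrite /mxtrace (bigD1 k) //= big1 => [|j jk].
    by rewrite !mxE eqxx addr0.
  by rewrite !mxE (negbTE jk).
suff -> : delta_mx k k =
    delta_mx k (0 : 'I_1) *m 1%:M *m (delta_mx k (0 : 'I_1))^t* :> 'M[R[i]]_d.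
  by apply: psdmx_congr; exact: psdmx1.
rewrite mulmx1 trmx_delta map_delta_mx.
by rewrite mul_delta_mx.
Qed.

(** Ensures that the infimum defining [opt_loss] runs over a nonempty set. The witness always
    prepares the basis state of index [k]. *)
Lemma eb_protocol_inhabited (R : realType) (n d : nat) (k : 'I_d) :
  inhabited (eb_protocol R n d).
Proof.
have mP : forall f : R[i] -> R, forall i j,
    measurable_fun [set: unit] (fun=> f ((delta_mx k k : 'M[R[i]]_d) i j)).
  by move=> f i j; exact: measurable_cst.
exact: (inhabits (@EbProtocol R n d _ unit _ (fun=> delta_mx k k)
  (is_povm_trivial R _) (fun=> density_delta R k) (mP _) (mP _))).
Qed.

(* An infimum over a set that is not bounded below is the junk value 0, which
   is also at most [e]; so no lower bound on the losses has to be proved. *)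
Lemma opt_loss_succ (R : realType) (d : nat) (p : 'I_d -> R) (k : 'I_d)
    (n : nat) (e : R) :
  is_spectrum p -> 0 <= e -> opt_loss p k n <= e -> opt_loss p k n.+1 <= e.
Proof.
move=> hp e0; rewrite /opt_loss.
set S := [set l | _] => hS; set S' := [set l | _].
have [hS'|hS'] := pselect (has_inf S'); last by rewrite inf_out.
apply: le_trans hS; apply: lb_le_inf.
  by have [T] := eb_protocol_inhabited R n k; exists (worst_loss p k T), T.
move=> l [T ->]; apply: ge_inf; first exact: hS'.2.
by exists (eb_discard T); rewrite worst_loss_discard.
Qed.

Lemma opt_loss_le_mono (R : realType) (d : nat) (p : 'I_d -> R) (k : 'I_d)
    (n N : nat) (e : R) :
  is_spectrum p -> 0 <= e -> (n <= N)%N ->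
  opt_loss p k n <= e -> opt_loss p k N <= e.
Proof.
move=> hp e0 /subnK <-; elim: (N - n)%N => // j IH hn.
by rewrite addSn; apply: opt_loss_succ => //; exact: IH.
Qed.

(** * Real estimates behind the sample size bound *)

Lemma expRN_le_inv (R : realType) (y : R) : 0 < y -> expR (- y) <= y^-1.
Proof.
move=> y0; rewrite expRN lef_pV2 ?posrE ?expR_gt0 //.
by apply: le_trans (expR_ge1Dx y); rewrite lerDr.
Qed.

(** Let [r] be the square root of [a / e]. Choosing [N] at least [r] makes the exponential at most
    [1 / (c * r)], the source of [8 / c]. Choosing [N] at most [n + 2 * r] loses [2 * r], which is
    the fraction [4 / r] of the main term [r ^+ 2 / 2]. *)
Lemma sample_size_bound (R : realType) (a n : nat) (e c : R) :
  0 < e -> 0 < c -> 1 <= Num.sqrt (a%:R / e) ->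
  (forall N : nat, (n <= N)%N ->
     (1 - 8 * expR (- (c * N%:R))) * (a%:R / (2 * (N + a)%:R)) <= e) ->
  a%:R / (2 * e) * (1 - (8 / c + 4) / Num.sqrt (a%:R / e)) - a%:R <= n%:R.
Proof.
move=> e0 c0; set r := Num.sqrt _ => r1 hN.
have r0 : 0 < r by apply: lt_le_trans r1.
have xE : a%:R / e = r ^+ 2.
  by rewrite sqr_sqrtr // divr_ge0 // ltW.
pose N := maxn n (Num.truncn r).+1.
have rN : r <= N%:R.
  apply: le_trans (ltW (Num.Theory.truncnS_gt r)) _.
  by rewrite ler_nat leq_maxr.
(* If the maximum is the second term, it is at most [r + 1], hence at most [2 * r] because
   [1 <= r]. *)
have Nle : N%:R <= n%:R + 2 * r.
  rewrite /N /maxn; case: ifP => _.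
    rewrite -natr1; have : (Num.truncn r)%:R <= r by rewrite truncn_le ltW.
    by have := ler0n R n; lra.
  by lra.
have N0 : 0 < N%:R :> R by apply: lt_le_trans rN.
have aN0 : 0 < (N + a)%:R :> R by rewrite natrD ltr_wpDr.
have := hN N (leq_maxl _ _); rewrite mulrA ler_pdivrMr ?mulr_gt0 // => hle.
have expN : expR (- (c * N%:R)) <= (c * r)^-1.
  apply: le_trans (expRN_le_inv _) _; first exact: mulr_gt0.
  by rewrite lef_pV2 ?posrE ?mulr_gt0 // ler_pM2l.
have aE : a%:R = e * r ^+ 2 :> R by rewrite -xE mulrC divfK // gt_eqF.
have h2 : (1 - 8 * (c * r)^-1) * (e * r ^+ 2) <= e * (2 * (N%:R + a%:R)).
  rewrite natrD in hle; apply: le_trans hle; rewrite -aE.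
  by apply: ler_wpM2r => //; lra.
have h3 : (1 - 8 * (c * r)^-1) * r ^+ 2 <= 2 * (N%:R + a%:R).
  by rewrite -(ler_pM2l e0) mulrCA.
have -> : a%:R / (2 * e) = r ^+ 2 / 2 by rewrite invfM mulrA mulrAC xE.
have -> : r ^+ 2 / 2 * (1 - (8 / c + 4) / r) =
    (1 - 8 * (c * r)^-1) * r ^+ 2 / 2 - 2 * r.
  by field; rewrite !gt_eqF.
by lra.
Qed.
Theorem corollaryS4p9 (R : realType) (I : Type) (F : set_system I)
    (FF : ProperFilter F)
    (d : I -> nat) (k : forall i, 'I_(d i)) (p : forall i, 'I_(d i) -> R)
    (eps : I -> R) (Dmin : R)
    (hp : forall i, is_spectrum (p i))
    (hk : forall i, simple_eigenvalue (p i) (k i))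
    (Dmin_gt0 : 0 < Dmin)
    (hD : forall i, Dmin <= gap (p i) (k i))
    (eps_gt0 : forall i, 0 < eps i)
    (hL : forall i (n : nat),
       (1 - 8 * expR (- (n%:R * gap (p i) (k i) ^+ 2 / 256)))
         * ((nbelow (k i))%:R / (2 * (n + nbelow (k i))%:R))
       <= opt_loss (p i) (k i) n)
    (hregime : (fun i => (nbelow (k i))%:R / eps i) @ F --> +oo) :
  (exists2 o : I -> R, o @ F --> (0 : R) &
     \forall i \near F,
       (((nbelow (k i))%:R / (2 * eps i) * (1 - o i) - (nbelow (k i))%:R)%:E
        <= sample_complexity (p i) (k i) (eps i))%E)
  /\
  (forall eps0 : R, eps0 < 1 / 2 -> (\forall i \near F, eps i <= eps0) ->
     exists2 c : R, 0 < c &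
       \forall i \near F,
         ((c * ((nbelow (k i))%:R / eps i))%:E
          <= sample_complexity (p i) (k i) (eps i))%E).
Proof.
(* A decay rate valid for all [i], as every gap is at least [Dmin]; the error [o i] then depends on
   [i] only through [x i]. *)
pose c : R := Dmin ^+ 2 / 256.
have c0 : 0 < c by rewrite divr_gt0 ?exprn_gt0.
pose x i : R := (nbelow (k i))%:R / eps i.
pose r i : R := Num.sqrt (x i).
pose o i : R := (8 / c + 4) / r i.
have r_y : r @ F --> +oo.
  apply/cvgryPge => A.
  have /cvgryPge/(_ (Num.max 0 A ^+ 2)) := hregime.
  apply: filterS => i xA; apply: (@le_trans _ _ (Num.max 0 A)).
    by rewrite le_max lexx orbT.
  by rewrite -[leLHS]ger0_norm ?le_max ?lexx // -sqrtr_sqr ler_wsqrtr.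
have r_ge1 : \forall i \near F, 1 <= r i by move/cvgryPge : r_y; exact.
have o0 : o @ F --> (0 : R).
  rewrite -(mulr0 (8 / c + 4)); apply: cvgMr; apply/gtr0_cvgV0 => //.
  by near=> i; apply: lt_le_trans (near r_ge1 i _).
have main : \forall i \near F,
    (((nbelow (k i))%:R / (2 * eps i) * (1 - o i) - (nbelow (k i))%:R)%:E
     <= sample_complexity (p i) (k i) (eps i))%E.
  apply: filterS r_ge1 => i ri1; rewrite /sample_complexity.
  case: pselect => [ex|_]; last by rewrite leey.
  case: ex_minnP => n /asboolP hn _; rewrite lee_fin.
  apply: sample_size_bound => // N nN.
  apply: le_trans (opt_loss_le_mono (hp i) (ltW (eps_gt0 i)) nN hn).
  apply: le_trans (hL i N); apply: ler_wpM2r; first exact: divr_ge0.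
  rewrite lerD2l lerN2 ler_pM2l // ler_expR lerN2 mulrC mulrA.
  apply: ler_wpM2r; first by rewrite invr_ge0.
  apply: ler_wpM2l => //; rewrite ler_pXn2r ?nnegrE ?(ltW Dmin_gt0) //.
  by apply: le_trans (hD i); exact: ltW.
split; first by exists o.
move=> eps0 eps0_lt hle.
(* The lower bound equals [((1 - o i) / 2 - eps i) * x i]. Without [o i] its coefficient is at least
   [(1 - 2 * eps0) / 2], positive as [eps0 < 1 / 2]; half of this is kept and the other half absorbs
   [o i / 2]. *)
exists ((1 - 2 * eps0) / 4); first by rewrite divr_gt0 //; lra.
have o_small : \forall i \near F, o i <= (1 - 2 * eps0) / 2.
  apply: (cvgr_le _ o0); rewrite divr_gt0 //; lra.
near=> i; apply: le_trans (near main i _) => //; rewrite lee_fin.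
have ei : eps i <= eps0 by near: i.
have oi : o i <= (1 - 2 * eps0) / 2 by near: i.
have e0 := eps_gt0 i.
have -> : (nbelow (k i))%:R / (2 * eps i) * (1 - o i) - (nbelow (k i))%:R =
    ((1 - o i) / 2 - eps i) * ((nbelow (k i))%:R / eps i).
  by field; rewrite gt_eqF.
by apply: ler_wpM2r; [exact: divr_ge0 (ltW e0)|lra].
Unshelve. all: by end_near.
Qed.
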